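(* Let $\Phi$ and $\Psi$ be two sets of Sudoku propositions. If $\Phi \vdash \Psi$ then $\Phi \models \Psi$.
   Context: A Sudoku proposition is a formal symbol $r_ic_j \not\approx d$ with $i,j,d\in\{1,\dots,9\}$. Sudoku formulas are built inductively from Sudoku propositions and the constants $\top,\bot$ using $\lnot,\land,\lor,\Rightarrow,\Leftrightarrow$. A grid is a $9\times 9$ matrix $\mathcal{A}=[A_{ij}]_{9\times 9}$ of nonempty subsets $A_{ij}\subseteq\{1,\dots,9\}$; it is full if $|A_{ij}|=1$ for all $i,j$. Satisfaction $\mathcal{A}\models\phi$: $\mathcal{A}\models\top$ always, $\mathcal{A}\models\bot$ never, $\mathcal{A}\models r_ic_j\not\approx d$ iff $d\notin A_{ij}$, and the connectives are interpreted classically (two-valued truth tables). For a set $\Phi$ of formulas, $\mathcal{A}\models\Phi$ means $\mathcal{A}\models\phi$ for all $\phi\in\Phi$. Write $r_ic_j\equiv d$ for $\bigwedge_{s\ne d} r_ic_j\not\approx s$, and $r_ic_j\parallel r_\ell c_m$ for $\bigwedge_{1\le d\le 9}((r_ic_j\equiv d\Rightarrow r_\ell c_m\not\approx d)\land(r_\ell c_m\equiv d\Rightarrow r_ic_j\not\approx d))$. The set $\Sigma_{ax}$ consists of 27 formulas, one for each row, each column and each of the nine standard $3\times 3$ boxes: the conjunction of $r_ic_j\parallel r_\ell c_m$ over all pairs of distinct cells in that row, column or box. A Sudoku grid is a grid $\mathcal{A}$ with $\mathcal{A}\models\Sigma_{ax}$ (i.e. whenever $A_{ij}=\{d\}$,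 $d$ belongs to no $A_{\ell m}$ for another cell in the same row, column or box). A full Sudoku grid is a Sudoku grid that is full. A Sudoku axiom is a Sudoku formula that holds in every full Sudoku grid; $\Delta_{ax}$ is the set of all Sudoku axioms. For a set $\Phi$ of Sudoku formulas and a Sudoku formula $\alpha$, $\Phi\vdash\alpha$ means there is a finite sequence $\phi_1,\dots,\phi_n=\alpha$ of Sudoku formulas such that each $\phi_i$ is in $\Delta_{ax}$, or in $\Phi$, or is obtained by modus ponens from earlier formulas (there are $p,q<i$ with $\phi_q$ equal to $\phi_p\Rightarrow\phi_i$). $\Phi\vdash\Psi$ means $\Phi\vdash\alpha$ for all $\alpha\in\Psi$. A grid $\mathcal{S}=[S_{ij}]$ is a solution of a grid $\mathcal{A}=[A_{ij}]$ if $\mathcal{S}$ is full and $S_{ij}\subseteq A_{ij}$ for all $i,j$. For sets $\Phi,\Psi$ of Sudoku propositions, $\Phi\models\Psi$ means: for every Sudoku grid $\mathcal{A}$ with $\mathcal{A}\models\Phi$, and every full Sudoku grid $\mathcal{S}$ which is a solution of $\mathcal{A}$, $\mathcal{S}\models\Psi$. *)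

(* Defs.v *)
From mathcomp Require Import all_boot all_order all_algebra.
From mathcomp Require Import classical_sets.
Set Implicit Arguments.
Unset Strict Implicit.
Unset Printing Implicit Defensive.

Local Open Scope classical_set_scope.

(* Rows, columns and digits 1..9 are all encoded as 0..8. *)
Definition digit := 'I_9.
Definition cell := ('I_9 * 'I_9)%type.

(* [Neq (i, j) d] is the symbol  r_i c_j !~ d. *)
Inductive proposition := Neq of cell & digit.

Inductive formula :=
  | Atom of proposition
  | Top
  | Bot
  | Not of formula
  | And of formula & formula
  | Or of formula & formula
  | Imp of formula & formula
  | Iff of formula & formula.

Record grid := Grid {
  grid_mx :> 'M[{set digit}]_9;
  grid_neq0 : forall i j, grid_mx i j != finset.set0 }.

Definition full (A : grid) : Prop := forall i j, #|A i j| = 1.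

Fixpoint sat (A : grid) (phi : formula) : bool :=
  match phi with
  | Atom (Neq c d) => d \notin A c.1 c.2
  | Top => true
  | Bot => false
  | Not a => ~~ sat A a
  | And a b => sat A a && sat A b
  | Or a b => sat A a || sat A b
  | Imp a b => sat A a ==> sat A b
  | Iff a b => sat A a == sat A b
  end.

Definition sat_set (A : grid) (Phi : set formula) : Prop :=
  forall phi, Phi phi -> sat A phi.

Definition is_digit (c : cell) (d : digit) : formula :=
  \big[And/Top]_(s : digit | s != d) Atom (Neq c s).

Definition excludes (c c' : cell) : formula :=
  \big[And/Top]_(d : digit)
    And (Imp (is_digit c d) (Atom (Neq c' d)))
        (Imp (is_digit c' d) (Atom (Neq c d))).

(* The conjunction ranges over ordered pairs of distinct cells;
   [excludes] is symmetric up to the order of its conjuncts. *)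
Definition house_axiom (H : {set cell}) : formula :=
  \big[And/Top]_(p : cell * cell | [&& p.1 \in H, p.2 \in H & p.1 != p.2])
    excludes p.1 p.2.

Definition row_cells (i : 'I_9) : {set cell} := finset (fun c : cell => c.1 == i).

Definition col_cells (j : 'I_9) : {set cell} := finset (fun c : cell => c.2 == j).

Definition box_cells (b : 'I_3 * 'I_3) : {set cell} :=
  finset (fun c : cell => (c.1 %/ 3 == b.1) && (c.2 %/ 3 == b.2)).

Definition Sigma_ax : set formula :=
  range (house_axiom \o row_cells) `|`
  range (house_axiom \o col_cells) `|`
  range (house_axiom \o box_cells).

Definition sudoku_grid (A : grid) : Prop := sat_set A Sigma_ax.

Definition full_sudoku_grid (A : grid) : Prop := sudoku_grid A /\ full A.

Definition Delta_ax : set formula :=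
  [set phi | forall S : grid, full_sudoku_grid S -> sat S phi].

Definition derivation (Phi : set formula) (s : seq formula) : Prop :=
  forall i, i < size s ->
    [\/ Delta_ax (nth Top s i),
        Phi (nth Top s i) |
        exists p q, [/\ p < i, q < i &
          nth Top s q = Imp (nth Top s p) (nth Top s i)]].

Definition provable (Phi : set formula) (alpha : formula) : Prop :=
  exists s : seq formula, derivation Phi (rcons s alpha).

Definition proves (Phi Psi : set formula) : Prop :=
  forall alpha, Psi alpha -> provable Phi alpha.

Definition solution (S A : grid) : Prop :=
  full S /\ forall i j, S i j \subset A i j.

Definition entails (Phi Psi : set proposition) : Prop :=
  forall A : grid, sudoku_grid A -> sat_set A (Atom @` Phi) ->
  forall S : grid, full_sudoku_grid S -> solution S A ->
  sat_set S (Atom @` Psi).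

(* Main.v *)
(* Digits excluded from a cell of a grid stay excluded in every solution, so a
   full Sudoku solution of a model of Phi is itself a model of Phi; on such full
   grids all Sudoku axioms hold, hence derivations are sound. *)
Require Import Defs.
From mathcomp Require Import all_boot all_order all_algebra.
From mathcomp Require Import classical_sets.

Local Open Scope classical_set_scope.

(** Strong induction on the position in the derivation: both premises of modus ponens stand earlier,
    and the truth table of [Imp] passes truth on. *)
Lemma provable_sound (Phi : set formula) (alpha : formula) (S : grid) :
  full_sudoku_grid S -> sat_set S Phi -> provable Phi alpha -> sat S alpha.
Proof.
move=> fullS satPhi [s der].
have sat_nth i : i < size (rcons s alpha) -> sat S (nth Top (rcons s alpha) i).
  elim/ltn_ind: i => i IH lti.
  have [ax | /satPhi // | [p [q [ltp ltq eqq]]]] := der i lti; first exact: ax.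
  have := IH q ltq (ltn_trans ltq lti).
  by rewrite eqq /= (IH p ltp (ltn_trans ltp lti)).
(* Position [size s] of [rcons s alpha] holds [alpha] itself. *)
by have := sat_nth (size s); rewrite size_rcons nth_rcons ltnn eqxx => ->.
Qed.

(** Special to atoms, which deny membership: a negated atom puts a digit in a cell, and a solution
    may drop that digit. *)
Lemma sat_set_solution (A S : grid) (Phi : set proposition) :
  solution S A -> sat_set A (Atom @` Phi) -> sat_set S (Atom @` Phi).
Proof.
move=> [_ subSA] satA _ [[c d] Phicd <-] /=.
have /= := satA (Atom (Neq c d)) (imageP _ Phicd).
by apply: contra; apply: (fintype.subsetP (subSA _ _)).
Qed.

Theorem theorem5p3 (Phi Psi : set proposition) :
  proves (Atom @` Phi) (Atom @` Psi) -> entails Phi Psi.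
Proof.
move=> prf A _ satA S fullS solS psi /prf.
exact: (provable_sound _ _ _ fullS (sat_set_solution _ _ _ solS satA)).
Qed.
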